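(* Fix a constant positive integer $k$ and a constant bound $\Delta$ on vertex degrees. Then every rooted directed tree $T$ with $n$ vertices and maximum degree at most $\Delta$ admits a persistent reversible pebbling using $O(n^{1/k})$ pebbles and $O(n)$ pebbling moves, where the implied constants depend only on $k$ and $\Delta$.
   Context: A rooted directed tree is a directed graph whose underlying undirected graph is a tree and which has a vertex $r$ (the root) reachable by a directed path from every vertex. A persistent reversible pebbling of $T$ is a sequence $P_1,\dots,P_m$ of vertex subsets with $P_1=\emptyset$, $P_m=\{r\}$, such that each $P_i$ ($i\ge2$) is obtained from $P_{i-1}$ by adding or removing exactly one vertex $v$ (a pebbling move), all of whose in-neighbours lie in $P_{i-1}$. Its number of pebbles is $\max_i|P_i|$ and its number of moves is $m-1$. *)

(* Defs.v *)
From mathcomp Require Import all_boot.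

Set Implicit Arguments.
Unset Strict Implicit.
Unset Printing Implicit Defensive.

(* A directed graph on the vertex set T is a relation e : rel T, where e u v
   means that there is an edge from u to v. *)

Definition underlying (T : finType) (e : rel T) : rel T :=
  [rel u v | e u v || e v u].

Definition acyclic (T : finType) (g : rel T) : Prop :=
  forall s : seq T, 2 < size s -> ~ ucycle g s.

(* The first clause excludes loops and pairs of opposite edges, which a
   relation on T cannot otherwise distinguish from a single undirected edge
   once it has been symmetrised. *)
Definition oriented_tree (T : finType) (e : rel T) : Prop :=
  [/\ forall u v : T, ~~ (e u v && e v u),
      forall u v : T, connect (underlying e) u v
    & acyclic (underlying e)].

(* Edges point towards the root r. *)
Definition rooted_tree (T : finType) (e : rel T) (r : T) : Prop :=
  oriented_tree e /\ forall v : T, connect e v r.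

(* Total degree: in-neighbours and out-neighbours together. *)
Definition degree (T : finType) (e : rel T) (v : T) : nat :=
  #|[set u | underlying e v u]|.

Definition pebbling_move (T : finType) (e : rel T) : rel {set T} :=
  [rel A B : {set T} | [exists v : T,
     [&& (v \notin A) && (B == v |: A) || (v \in A) && (B == A :\ v)
       & [forall u : T, e u v ==> (u \in A)]]]].

Definition persistent_pebbling (T : finType) (e : rel T) (r : T)
    (P : seq {set T}) : Prop :=
  [/\ ohead P = Some set0,
      last set0 P = [set r]
    & sorted (pebbling_move e) P].

Definition num_pebbles (T : finType) (P : seq {set T}) : nat :=
  \max_(A <- P) #|A|.

Definition num_moves (T : finType) (P : seq {set T}) : nat := (size P).-1.

(* Main.v *)
Require Import Defs.
From mathcomp Require Import all_boot.

Set Implicit Arguments.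
Unset Strict Implicit.
Unset Printing Implicit Defensive.

(** By induction on [j], a set [S] of at most about [q ^ j] vertices, all of
    whose outside in-neighbours already carry pebbles, can have any of its
    vertices pebbled with [O(j * q)] additional pebbles and [2 ^ j * #|S|] moves.
    For the step put [s = q ^ j] and cut off from [S] a minimal subtree having
    at least [s] vertices; bounded degree keeps it of size [O(s)], so the
    induction hypothesis pebbles its top vertex [v]. As [v] is the only vertex
    of the subtree with an edge to the rest of [S], one can recurse on the rest
    and finally unpebble [v] by reversing the first phase. Each cut removes at
    least [s] vertices and keeps one pebble, so the recursion costs [#|S| / s]
    pebbles, and every vertex is charged twice for the moves of the previous
    level. The theorem is the case [j = k], [q = O(n ^ (1/k))]. *)

Section RootedTree.
Variables (T : finType) (e : rel T).

(** * Directed acyclicity and uniqueness of out-neighbours *)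

Lemma sub_underlying : subrel e (underlying e).
Proof. by move=> u v; rewrite /underlying /= => ->. Qed.

Lemma underlying_sym : symmetric (underlying e).
Proof. by move=> u v; rewrite /underlying /= orbC. Qed.

(** A directed path from [v] back to [u], made simple, closes up with the edge from [u] to [v] into
    a cycle of the underlying graph. Paths of length 0 or 1 give a loop or a pair of opposite edges
    instead. *)
Lemma oriented_tree_no_directed_cycle :
  oriented_tree e -> forall u v, e u v -> ~~ connect e v u.
Proof.
case=> anti _ acyc u v euv; apply/negP => /connectP [p0 ep0 eq_u].
move: eq_u; case/shortenP: ep0 => p ep up _ eq_u.
case: p ep up eq_u => [|w [|w' p]] ep up eq_u.
- by move: (anti u v); rewrite eq_u /= in euv *; rewrite euv.
- by move: ep (anti u v); rewrite euv eq_u /= andbT => ->.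
apply: (acyc [:: v, w, w' & p]) => //.
rewrite /ucycle up andbT /cycle rcons_path.
have -> : underlying e (last v [:: w, w' & p]) v.
  by rewrite -eq_u sub_underlying.
by rewrite andbT; apply: sub_path ep; apply: sub_underlying.
Qed.

(** By acyclicity, directed paths from out-neighbours of [u] to [r] avoid [u]. Those from [v] and
    [w] join at [r] into an undirected path avoiding [u], which [u] would close into a cycle if [v]
    and [w] differed. *)
Lemma rooted_tree_out_neighbour_uniq r : rooted_tree e r ->
  forall u v w, e u v -> e u w -> v = w.
Proof.
case=> tree_e to_r u v w euv euw; apply/eqP/negPn/negP => neq_vw.
have acy := oriented_tree_no_directed_cycle tree_e.
have [_ _ acyc] := tree_e.
pose g := [rel x y | [&& underlying e x y, x != u & y != u]].
have g_sym : connect_sym g.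
  by apply: sym_connect_sym => x y; rewrite /= underlying_sym [(x != u) && _]andbC.
have g_to_r x : e u x -> connect g x r.
  move=> eux; have /connectP [p ep ->] := to_r x.
  have: all (predC1 u) (x :: p).
    apply/allP => y xp_y; apply: contraNneq (acy _ _ eux) => <-.
    exact: path_connect ep _ xp_y.
  move=> all_p; apply/connectP; exists p => //.
  elim: p x ep all_p {eux} => //= y p IHp x /andP [exy ep] /and3P [nxu nyu all_p].
  by rewrite IHp /= ?nyu // sub_underlying // nxu.
have : connect g v w.
  by apply: connect_trans (g_to_r _ euv) _; rewrite g_sym g_to_r.
case/connectP => p0 gp0 def_w; move: def_w neq_vw euw.
case/shortenP: gp0 => p gp up _ ->.
case: p gp up => [|x p] gp up; first by rewrite eqxx.
move=> _ euw; apply: (acyc [:: u, v, x & p]) => //.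
have nvu : v != u by case/andP: gp => /and3P [].
have u_notin : u \notin [:: v, x & p].
  rewrite inE negb_or eq_sym nvu /=.
  elim: (x :: p) v gp {euv euw nvu up} => //= y s IHs z /andP [/and3P [_ _ nyu] gs].
  by rewrite inE negb_or eq_sym nyu (IHs _ gs).
rewrite /ucycle cons_uniq u_notin up andbT /cycle rcons_path.
have -> : path (underlying e) u [:: v, x & p].
  move: gp; rewrite /= (sub_underlying euv) => /andP [/and3P [-> _ _] gp] /=.
  by apply: sub_path gp => y z /and3P [].
by rewrite /= underlying_sym sub_underlying.
Qed.

(** * Reversible sequences of moves *)

Lemma pebbling_move_sym : (forall v, ~~ e v v) -> symmetric (pebbling_move e).
Proof.
move=> irr; suff sub A B : pebbling_move e A B -> pebbling_move e B A.
  by move=> A B; apply/idP/idP; apply: sub.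
case/existsP => v /andP [AB /forallP in_v]; apply/existsP; exists v.
case/orP: AB => /andP [vA /eqP ->].
  rewrite setU11 setU1K // eqxx /=; apply/forallP => u; apply/implyP => euv.
  by rewrite inE (implyP (in_v u) euv) orbT.
rewrite !inE eqxx setD1K // eqxx /=; apply/forallP => u; apply/implyP => euv.
rewrite !inE (implyP (in_v u) euv) andbT.
(* Without loops, removing [v] leaves its in-neighbours pebbled. *)
by apply: contraTneq euv => ->.
Qed.

Definition reaches (p m : nat) (A B : {set T}) : Prop :=
  exists s, [/\ path (pebbling_move e) A s, last A s = B, size s <= m
              & all (fun X : {set T} => #|X| <= p) (A :: s)].

Lemma reaches_weaken p p' m m' A B :
  p <= p' -> m <= m' -> reaches p m A B -> reaches p' m' A B.
Proof.
move=> lep lem [s [es ls ms /allP ps]]; exists s; split => //.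
  exact: leq_trans ms lem.
by apply/allP => X /ps /= leX; apply: leq_trans leX lep.
Qed.

Lemma reaches_trans p m1 m2 A B C :
  reaches p m1 A B -> reaches p m2 B C -> reaches p (m1 + m2) A C.
Proof.
move=> [s1 [es1 <- ms1 ps1]] [s2 [es2 <- ms2 /andP [_ ps2]]].
exists (s1 ++ s2); split; first by rewrite cat_path es1.
- by rewrite last_cat.
- by rewrite size_cat leq_add.
- by rewrite -cat_cons all_cat ps1.
Qed.

Lemma reaches_sym p m A B : (forall v, ~~ e v v) ->
  reaches p m A B -> reaches p m B A.
Proof.
move=> irr [s [es <- ms ps]]; exists (rev (belast A s)); split.
- by rewrite rev_path; apply: sub_path es => X Y; rewrite /= pebbling_move_sym.
- by case: s {es ms ps} => //= X s; rewrite rev_cons last_rcons.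
- by rewrite size_rev size_belast.
- by rewrite -rev_rcons -lastI all_rev.
Qed.

(* The in-neighbours of [S] lying outside [S] carry the pebbles of [B]. *)
Definition fed (S B : {set T}) : Prop :=
  [disjoint S & B] /\ forall u v, v \in S -> e u v -> u \in S :|: B.

(** Both bounds are relative: [p] counts pebbles on top of those of [B], and [m] moves per vertex of
    [S], so that the move counts of disjoint pieces add up. *)
Definition pebblable (p m N : nat) : Prop :=
  forall (S B : {set T}) r, #|S| <= N -> r \in S -> fed S B ->
    reaches (#|B| + p) (m * #|S|) B (r |: B).

Lemma pebblable1 : (forall v, ~~ e v v) -> pebblable 1 1 1.
Proof.
move=> irr S B r leS rS [dis in_S].
have defS : S = [set r].
  by apply/esym/eqP; rewrite eqEcard sub1set rS cards1.
have nrB : r \notin B by rewrite (disjointFr dis).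
exists [:: r |: B]; split=> //=.
- rewrite andbT; apply/existsP; exists r; rewrite nrB eqxx /=.
  apply/forallP => u; apply/implyP => eur.
  have := in_S u r rS eur; rewrite defS !inE => /orP [/eqP eq_ur|//].
  by move: (irr r); rewrite -{1}eq_ur eur.
- by rewrite defS cards1.
- by rewrite leq_addr cardsU1 nrB addnC leqnn.
Qed.

(** * Subtrees cut off from a set of vertices *)

Definition descendants (S : {set T}) (v : T) : {set T} :=
  [set x in S | connect [rel a b | e a b && (a \in S)] x v].

Lemma descendants_subset S v : descendants S v \subset S.
Proof. by apply/subsetP => x; rewrite inE => /andP []. Qed.

Lemma mem_descendants (S : {set T}) v : v \in S -> v \in descendants S v.
Proof. by rewrite inE connect0 andbT. Qed.

Lemma fed_descendants (S B : {set T}) v : v \in S -> fed S B ->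
  fed (descendants S v) B.
Proof.
move=> vS [dis in_S]; split.
  exact: disjointWl (descendants_subset S v) dis.
move=> u w; rewrite !inE => /andP [wS cwv] euw.
have := in_S u w wS euw; rewrite inE => /orP [uS|->]; last by rewrite orbT.
by rewrite uS (connect_trans _ cwv) // connect1 //= euw.
Qed.

Hypothesis acy : forall u v, e u v -> ~~ connect e v u.
Hypothesis out_uniq : forall u v w, e u v -> e u w -> v = w.
Let no_loop v : ~~ e v v.
Proof. by apply/negP => evv; move: (acy evv); rewrite connect0. Qed.

Variable D : nat.
Hypothesis D_gt0 : 0 < D.
Hypothesis in_deg : forall v, #|[set u | e u v]| <= D.

(** A vertex of the subtree other than [v] has a first step towards [v]. By uniqueness this is its
    only out-edge, and it stays in the subtree; so only [v] can feed the rest. *)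
Lemma fed_setD_descendants (S B : {set T}) v : v \in S -> fed S B ->
  fed (S :\: descendants S v) (v |: B).
Proof.
move=> vS [dis in_S]; split.
  rewrite disjoint_sym disjoints_subset subUset sub1set !inE.
  rewrite vS connect0 /= -disjoints_subset disjoint_sym.
  by rewrite (disjointWl (subsetDl _ _)).
move=> u w; rewrite !inE => /andP [nw wS] euw; rewrite wS /= in nw.
have := in_S u w wS euw; rewrite inE => /orP [uS|->]; last by rewrite !orbT.
rewrite uS /=; have [-> | neq_uv] := eqVneq u v; first by rewrite orbT.
apply/orP; left; rewrite andbT; apply: contra nw => /connectP [[|w' p] /=].
  by move=> _ eq_uv; rewrite eq_uv eqxx in neq_uv.
case/andP=> /andP [euw' _] ep ->; apply/connectP; exists p => //.
all: by rewrite (out_uniq euw euw').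
Qed.

(* The in-neighbours in [S] of a vertex minimizing [#|descendants S v|] have
   fewer than [s] descendants. *)
Lemma exists_medium_descendants (S : {set T}) s v0 :
  v0 \in S -> s <= #|descendants S v0| ->
  exists2 v, v \in S & s <= #|descendants S v| <= (D * s.-1).+1.
Proof.
move=> v0S lev0; pose P v := (v \in S) && (s <= #|descendants S v|).
have Pv0 : P v0 by rewrite /P v0S.
case: (arg_minnP (fun v => #|descendants S v|) Pv0) => v /andP [vS lev] minv.
exists v => //; rewrite lev /=.
have small c : c \in S -> e c v -> #|descendants S c| <= s.-1.
  move=> cS ecv; rewrite -ltnS; apply: contraTT isT; rewrite -leqNgt => ge_s.
  have /minv : P c by rewrite /P cS /=; apply: leq_trans ge_s; case: (s).
  (* The inclusion is strict: by acyclicity, [v] does not reach its in-neighbour [c]. *)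
  rewrite leqNgt proper_card //; apply/properP; split; last first.
    exists v; first exact: mem_descendants.
    rewrite inE negb_and; apply/orP; right.
    apply: contra (acy ecv); apply: connect_sub => x y /andP [exy _].
    exact: connect1.
  apply/subsetP => x; rewrite !inE => /andP [-> cxc] /=.
  by apply: connect_trans cxc _; rewrite connect1 //= ecv.
pose C := [set c in S | e c v].
have sub : descendants S v \subset v |: \bigcup_(c in C) descendants S c.
  apply/subsetP => x; rewrite !inE => /andP [xS /connectP [p]].
  case/lastP: p => [|p w]; first by move=> _ ->; rewrite eqxx.
  rewrite rcons_path last_rcons => /andP [ep /= /andP [ew lS]] def_v.
  apply/orP; right; apply/bigcupP; exists (last x p).
    by rewrite inE lS def_v.
  by rewrite inE xS; apply/connectP; exists p.
apply: leq_trans (subset_leq_card sub) _; rewrite cardsU1 -add1n.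
apply: leq_add; first by case: (_ \notin _).
apply: leq_trans (_ : \sum_(c in C) #|descendants S c| <= _).
  elim/big_rec2: _ => [|c a A _ leA]; first by rewrite cards0.
  by rewrite (leq_trans (leq_card_setU _ _)) // leq_add2l.
apply: leq_trans (_ : \sum_(c in C) s.-1 <= _).
  by apply: leq_sum => c; rewrite inE => /andP [cS ecv]; apply: small.
rewrite sum_nat_const leq_mul2r; apply/orP; right.
apply: leq_trans (in_deg v); apply: subset_leq_card.
by apply/subsetP => c; rewrite !inE => /andP [].
Qed.

(** * The recursion over levels *)

Lemma pebblable_step p m s : 0 < s -> pebblable p m (D * s.-1).+1 ->
  forall N, pebblable (p + N %/ s) (2 * m) N.
Proof.
move=> s_gt0 IH N S B r leS rS fedS.
(* With [#|S|] in place of [N], the budget shrinks at each cut. *)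
apply: (@reaches_weaken (#|B| + (p + #|S| %/ s)) _ (2 * m * #|S|)) => //.
  by rewrite !leq_add2l leq_div2r.
move: {2}#|S|.+1 (ltnSn #|S|) => n; elim: n S B r {leS} rS fedS => // n IHn.
move=> S B r rS fedS ltSn.
have direct v : v \in S -> r \in descendants S v ->
    #|descendants S v| <= (D * s.-1).+1 ->
    reaches (#|B| + (p + #|S| %/ s)) (2 * m * #|S|) B (r |: B).
  move=> vS rv lev; have := IH _ _ _ lev rv (fed_descendants vS fedS).
  apply: reaches_weaken; first by rewrite leq_add2l leq_addr.
  rewrite -mulnA mul2n -addnn; apply: leq_trans (leq_addr _ _).
  by rewrite leq_mul2l subset_leq_card ?orbT ?descendants_subset.
case: (ltnP #|descendants S r| s) => [ltr|ger].
  apply: (direct r) => //; first exact: mem_descendants.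
  rewrite -(prednK s_gt0) ltnS in ltr.
  by apply: leqW; apply: leq_trans ltr _; rewrite leq_pmull.
have [v vS /andP [gev lev]] := exists_medium_descendants rS ger.
have [rv|nrv] := boolP (r \in descendants S v); first exact: (direct v).
have [dis in_S] := fedS.
have subv := descendants_subset S v.
have vv := mem_descendants vS.
set S' := S :\: descendants S v.
have cardS : #|S| = #|descendants S v| + #|S'|.
  by rewrite -(cardsID (descendants S v) S) (setIidPr subv).
have nvB : v \notin B by rewrite (disjointFr dis).
have nrB : r \notin B by rewrite (disjointFr dis).
(* The quotient drops by at least one, which pays for the pebble kept on [v]. *)
have div_S : (#|S'| %/ s).+1 <= #|S| %/ s.
  have -> : (#|S'| %/ s).+1 = (s + #|S'|) %/ s.
    by rewrite divnDl // divnn s_gt0.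
  by rewrite leq_div2r // cardS leq_add2r.
have step1 : reaches (#|B| + (p + #|S| %/ s)) (m * #|descendants S v|) B (v |: B).
  apply: reaches_weaken (IH _ _ _ lev vv (fed_descendants vS fedS)) => //.
  by rewrite leq_add2l leq_addr.
have step2 : reaches (#|B| + (p + #|S| %/ s)) (2 * m * #|S'|)
                (v |: B) (r |: (v |: B)).
  have rS' : r \in S' by rewrite inE nrv.
  apply: reaches_weaken (IHn _ _ _ rS' (fed_setD_descendants vS fedS) _) => //.
    by rewrite cardsU1 nvB [true + _]addnC -addnA leq_add2l addnCA leq_add2l add1n.
  rewrite -ltnS; apply: leq_trans ltSn; rewrite ltnS cardS -{1}[#|S'|]add0n ltn_add2r.
  by apply/card_gt0P; exists v.
have step3 : reaches (#|B| + (p + #|S| %/ s)) (m * #|descendants S v|)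
                (r |: (v |: B)) (r |: B).
  rewrite setUCA; apply: (reaches_sym no_loop).
  (* The first phase can be replayed, and so reversed, with [r] pebbled because [r] lies outside the
     subtree. *)
  have fed3 : fed (descendants S v) (r |: B).
    have [dis' in_v] := fed_descendants vS fedS; split.
      rewrite disjoint_sym disjoints_subset subUset sub1set in_setC nrv /=.
      by rewrite -disjoints_subset disjoint_sym.
    by move=> u w wv /(in_v _ _ wv); rewrite !inE => /orP [->|->]; rewrite ?orbT.
  apply: reaches_weaken (IH _ _ _ lev vv fed3) => //.
  rewrite cardsU1 nrB [true + _]addnC -addnA leq_add2l addnC leq_add2l.
  by apply: leq_trans div_S.
have := reaches_trans (reaches_trans step1 step2) step3.
apply: reaches_weaken => //.
by rewrite cardS mulnDr addnAC addnn -mul2n mulnA.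
Qed.

(** The size bound at level [j] is the one [pebblable_step] requires for [s = q ^ j]. The next bound
    is at most [D * q ^ j.+1], as [D] is positive, so its quotient by [s] adds at most [D * q]
    pebbles. *)
Lemma pebblable_iter q j : 0 < q ->
  pebblable (j * (D * q)).+1 (2 ^ j) (D * (q ^ j).-1).+1.
Proof.
move=> q_gt0; elim: j => [|j IHj].
  by rewrite muln0; apply: pebblable1 no_loop.
have qj_gt0 : 0 < q ^ j by rewrite expn_gt0 q_gt0.
rewrite expnS => S B r leS rS fedS.
apply: reaches_weaken (pebblable_step qj_gt0 IHj leS rS fedS) => //.
rewrite leq_add2l addSn ltnS mulSn addnC leq_add2r.
rewrite -(mulnK (D * q) qj_gt0) leq_div2r // -mulnA -expnS.
by rewrite -{2}(prednK (_ : 0 < q ^ j.+1)) ?expn_gt0 ?q_gt0 // mulnS -add1n leq_add2r.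
Qed.

End RootedTree.

Lemma bounded_degree_tree_pebbling (T : finType) (e : rel T) r Delta k q :
  rooted_tree e r -> (forall v, degree e v <= Delta) -> 0 < q ->
  #|T| <= q ^ k ->
  exists P : seq {set T},
    [/\ persistent_pebbling e r P, num_pebbles P <= (k * (Delta.+1 * q)).+1
      & num_moves P <= 2 ^ k * #|T|].
Proof.
move=> tree_e degD q_gt0 leT.
have acy := oriented_tree_no_directed_cycle (proj1 tree_e).
have out_uniq := rooted_tree_out_neighbour_uniq tree_e.
(* The successor keeps the degree bound positive even when [Delta] is 0. *)
have in_deg v : #|[set u | e u v]| <= Delta.+1.
  apply: leqW; apply: leq_trans (degD v); apply: subset_leq_card.
  by apply/subsetP => u; rewrite !inE underlying_sym; apply: sub_underlying.
have fedT : fed e [set: T] set0.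
  by split=> [|u v _ _]; rewrite ?inE // disjoint_sym disjoints_subset sub0set.
have leN : #|[set: T]| <= (Delta.+1 * (q ^ k).-1).+1.
  rewrite cardsT; apply: leq_trans leT _.
  by case: (q ^ k) => // m; rewrite ltnS leq_pmull.
have := pebblable_iter acy out_uniq (ltn0Sn Delta) in_deg q_gt0 leN (in_setT r)
  fedT.
rewrite setU0 cards0 add0n cardsT => -[s [es ls ms /allP ps]].
exists (set0 :: s); split=> //.
by apply/bigmax_leqP_seq => A /ps.
Qed.

(* Real exponents and the constants *)
From mathcomp Require Import all_order all_algebra.
From mathcomp Require Import all_classical all_reals all_analysis.
Import Order.TTheory GRing.Theory Num.Theory.
Local Open Scope ring_scope.

Theorem mainTheorem10 (R : realType) (k Delta : nat) (hk : (0 < k)%N) :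
  exists Cp Cm : R, forall (T : finType) (e : rel T) (r : T),
    rooted_tree e r ->
    (forall v : T, (degree e v <= Delta)%N) ->
    exists P : seq {set T},
      [/\ persistent_pebbling e r P,
          (num_pebbles P)%:R <= Cp * (#|T|%:R `^ (k%:R^-1))
        & (num_moves P)%:R <= Cm * #|T|%:R].
Proof.
(* With [q = (Num.truncn x).+1], the extra 1 in the pebble bound is absorbed as one more [q]; the
   factor 2 comes from [q <= 2 * x], valid since [x >= 1]. *)
exists ((k * Delta.+1).+1 * 2)%:R, (2 ^ k)%:R => T e r tree_e degD.
have T_gt0 : (0 < #|T|)%N by apply/card_gt0P; exists r.
set x : R := #|T|%:R `^ k%:R^-1.
have x_ge1 : 1 <= x.
  by rewrite -[1](powRr0 (#|T|%:R : R)) ler_powR ?ler1n ?invr_ge0.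
have x_ge0 : 0 <= x := le_trans ler01 x_ge1.
have leT : (#|T| <= (Num.truncn x).+1 ^ k)%N.
  rewrite -(ler_nat R) natrX 
    -[leLHS]powRr1 // -[X in _ `^ X](@mulVf R k%:R) ?pnatr_eq0 -?lt0n //.
  rewrite powRrM powR_mulrn // lerXn2r ?nnegrE // ltW //.
  exact: truncnS_gt.
have [P [pebP pebbles moves]] :=
  bounded_degree_tree_pebbling tree_e degD (ltn0Sn _) leT.
exists P; split=> //; last by rewrite -natrM ler_nat.
apply: (@le_trans _ _ ((k * Delta.+1).+1 * (Num.truncn x).+1)%:R).
  by rewrite ler_nat (leq_trans pebbles) // mulnA mulSn -add1n leq_add2r.
rewrite !natrM -mulrA ler_wpM2l // mulr_natl mulr2n -natr1 lerD //.
by rewrite truncn_le.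
Qed.
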